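(* Let $G$ be a graph in which every vertex has infinite degree, and such that for every infinite cardinal $\alpha$, $G$ has at most $2^\alpha$ vertices of degree $\alpha$. Then $D'(G) \le 3$.
   Context: Graphs are undirected, without loops or multiple edges, possibly infinite; the degree of a vertex is its number of neighbors. An edge coloring of $G$ is any function from $E(G)$ to a set of colors (not required to be proper). An automorphism of $G$ preserves an edge coloring if it maps every edge to an edge of the same color. The distinguishing index $D'(G)$ is the least cardinal $d$ such that $G$ has an edge coloring with $d$ colors preserved only by the identity automorphism. *)

(* Defs.v *)
From mathcomp Require Import all_boot.
From mathcomp Require Import boolp classical_sets functions cardinality.

Set Implicit Arguments.
Unset Strict Implicit.
Unset Printing Implicit Defensive.

Local Open Scope classical_set_scope.
Local Open Scope card_scope.

(* The vertex type is arbitrary: it may be empty, finite or infinite of any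
   cardinality. *)
Record graph := Graph {
  vertex :> Type;
  adj : vertex -> vertex -> Prop;
  adj_sym : forall x y, adj x y -> adj y x;
  adj_irrefl : forall x, ~ adj x x
}.

Definition neighbors (G : graph) (v : G) : set G := [set w | adj v w].

(* Cardinals are represented by types up to bijection. *)
Definition has_degree (G : graph) (v : G) (A : Type) : Prop :=
  neighbors v #= [set: A].

Definition is_edge (G : graph) (e : set G) : Prop :=
  exists x y : G, adj x y /\ e = [set x; y].

(* Edges are unordered pairs of adjacent vertices; a subtype is used so that
   an edgeless graph has a coloring with the empty set of colors. *)
Definition edge (G : graph) : Type := {e : set G | is_edge e}.

Definition edge_coloring (G : graph) (C : Type) : Type := edge G -> C.

Definition automorphism (G : graph) (f : G -> G) : Prop :=
  bijective f /\ forall x y : G, adj (f x) (f y) <-> adj x y.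

(* The edge e' is the image of e under f. *)
Definition preserves (G : graph) (C : Type) (f : G -> G)
    (c : edge_coloring G C) : Prop :=
  forall e : edge G, exists e' : edge G,
    sval e' = f @` sval e /\ c e' = c e.

Definition distinguishing (G : graph) (C : Type) (c : edge_coloring G C) :
    Prop :=
  forall f : G -> G, automorphism f -> preserves f c -> forall x, f x = x.

(* The cardinal of D is the least cardinal d such that G has a distinguishing
   edge coloring with d colors. Such a least cardinal need not exist: for
   instance, K_2 has no distinguishing edge coloring at all. *)
Definition is_distinguishing_index (G : graph) (D : Type) : Prop :=
  (exists c : edge_coloring G D, distinguishing c) /\
  forall C : Type,
    (exists c : edge_coloring G C, distinguishing c) -> [set: D] #<= [set: C].

(* Main.v *)
Require Import Defs.
From mathcomp Require Import all_boot.
From mathcomp Require Import boolp classical_sets functions cardinality wochoice.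

Set Implicit Arguments.
Unset Strict Implicit.
Unset Printing Implicit Defensive.

Local Open Scope classical_set_scope.
Local Open Scope card_scope.

(** Take a maximal family of vertex-disjoint "ranked trees" in G. Below its
    root r, such a tree is a well-founded tree of ranks: a vertex of rank i has
    exactly one child of every rank j < i taken from a set of deg(r) ranks, so
    ranks are determined by isomorphism type; the set of ranks of the children
    of the root is a code, different for any two vertices of the same degree
    (there are 2^deg(r) codes available). Color the edges of these trees 2.
    Every vertex that is neither the root nor a leaf is adjacent to a leaf of
    rank None, which makes the root recognizable. Hence a color-preserving
    automorphism fixes the set X0 of all vertices of the trees.
    Now grow X0 transfinitely: from T pass to T together with all v having
    deg(v) neighbors in T. The new vertices of each degree are told apart by
    the subset of their neighbors in T to which they are joined by edges of
    color 1, and all other edges get color 0. So every stage is fixed. If the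
    last stage were not the whole of G, then each vertex v outside it would
    have deg(v) neighbors outside it; starting from an outside vertex of least
    degree one could embed one more ranked tree there, against maximality. *)

(** * Cardinals *)

Definition injects T U (f : T -> U) (A : set T) (B : set U) :=
  (forall x, A x -> B (f x)) /\
  (forall x y, A x -> A y -> f x = f y -> x = y).

(** Total functions are easier to compose than injections between subtypes. The default [u0] serves
    only when [B], and hence [A], is empty. *)
Lemma card_leW T U (u0 : U) (A : set T) (B : set U) :
  A #<= B -> exists f : T -> U, injects f A B.
Proof.
case: (pselect (B !=set0)) => [[b Bb]|B0].
  move=> /card_leP[f].
  pose g (x : T) := if pselect (A x) is left Ax then
     set_val (f (SigSub (mem_set Ax))) else b.
  exists g; split=> [x Ax|x y Ax Ay].
    by rewrite /g; case: pselect => // ?; exact: set_valP.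
  rewrite /g; case: pselect => // Ax'; case: pselect => // Ay' e.
  have /(congr1 set_val) // : SigSub (mem_set Ax') = SigSub (mem_set Ay').
  by apply: (@inj _ _ _ f); rewrite ?inE//; apply: val_inj.
have -> : B = set0 by apply/seteqP; split=> // x Bx; case: B0; exists x.
by move=> /card_le0P ->; exists (fun=> u0); split.
Qed.

Lemma injects_card_le T U (f : T -> U) (A : set T) (B : set U) :
  injects f A B -> A #<= B.
Proof.
move=> [fAB finj].
have : $|{injfun A >-> B}|.
  apply/injfunPex; exists f => // x y /set_mem Ax /set_mem Ay; exact: finj.
by move=> [g]; exact: inj_card_le g.
Qed.

Lemma set_picker U (u0 : U) :
  exists pick : set U -> U, forall A, A !=set0 -> A (pick A).
Proof.
have /choice[pick pickP] : forall A : set U, exists u, A !=set0 -> A u.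
  by move=> A; case: (pselect (A !=set0)) => [[a Aa]|?]; [exists a|exists u0].
by exists pick.
Qed.

Lemma wf_minimal T (lt : T -> T -> Prop) : well_founded lt ->
  forall A : set T, A !=set0 -> exists2 a, A a & forall b, A b -> ~ lt b a.
Proof.
move=> wf A [a]; elim/(well_founded_ind wf): a => a IH Aa.
have [|H] := pselect (exists2 b, A b & lt b a).
  by case=> b Ab ba; exact: IH ba Ab.
by exists a => // b Ab ba; apply: H; exists b.
Qed.

Lemma wf_irrefl T (lt : T -> T -> Prop) : well_founded lt -> forall x, ~ lt x x.
Proof. by move=> wf x; elim/(well_founded_ind wf): x => x IH h; exact: IH (h) (h). Qed.

Lemma exists_well_order T : exists lt : T -> T -> Prop,
  well_founded lt /\ forall x y, [\/ lt x y, x = y | lt y x].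
Proof.
have [R Rwo] := well_ordering_principle {classic T}.
pose lt (x y : T) := ~~ R y x.
have Rtot : total R by move=> x y; apply: (wo_chainW (withinW Rwo)).
have Ranti : antisymmetric R.
  move=> x y; apply: (wo_chain_antisymmetric (withinW Rwo)) => //.
exists lt; split.
  move=> x; apply: contrapT => nx.
  have [|z [[zN lb] _]] := Rwo [pred z : {classic T} | `[< ~ Acc lt z >]].
    by exists x; apply/asboolP.
  move/asboolP: (zN); apply; constructor => y yz; apply: contrapT => ny.
  by move: yz; rewrite /lt lb//; apply/asboolP.
move=> x y; rewrite /lt.
case: (boolP (R y x)) => yx; last by constructor.
case: (boolP (R x y)) => xy; last by constructor.
by constructor 2; apply: Ranti; rewrite xy yx.
Qed.

(** If some segment is as large as [I], take the least [a] bounding one and pull the order back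
    along an injection of [I] into that segment. A large segment of the new order would give a large
    segment below some [g b], which precedes [a]. *)
Lemma exists_initial_order T (I : set T) : exists lt : T -> T -> Prop,
  [/\ well_founded lt, (forall x y, I x -> I y -> [\/ lt x y, x = y | lt y x])
    & forall a, I a -> ~ (I #<= [set x | I x /\ lt x a]) ].
Proof.
have [lt [wf tri]] := exists_well_order T.
pose large := [set a | I #<= [set x | I x /\ lt x a] ].
have [lne|l0] := pselect (large !=set0); last first.
  by exists lt; split=> // a Ia le; apply: l0; exists a.
have [a la amin] := wf_minimal wf lne.
have [g [gI ginj]] := card_leW a la.
exists (fun x y => lt (g x) (g y)); split.
- move=> x; have [y] : exists y, y = g x by exists (g x).
  elim/(well_founded_ind wf): y x => y IH x yx; constructor => z zx.
  by apply: (IH (g z)) => //; rewrite yx.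
- move=> x y Ix Iy; case: (tri (g x) (g y)) => h; [by constructor| |by constructor].
  by constructor 2; exact: ginj.
move=> b Ib le; apply: (amin (g b)); last by have [] := gI _ Ib.
apply: card_le_trans le _; apply: (@injects_card_le _ _ g); split.
  by move=> x [Ix xb]; split=> //; have [] := gI _ Ix.
by move=> x y [Ix _] [Iy _]; exact: ginj.
Qed.

(* Along an order of initial type, fewer than [I] values are forbidden at each
   step, hence fewer than [N i]. *)
Lemma injective_choice T U (u0 : U) (I : set T) (N : T -> set U) :
  (forall i, I i -> I #<= N i) ->
  exists f : T -> U, (forall i, I i -> N i (f i)) /\
    (forall i j, I i -> I j -> f i = f j -> i = j).
Proof.
move=> IN; have [lt [wf tri ini]] := exists_initial_order I.
have [pick pickP] := set_picker u0.
pose avail i (rec : forall j, lt j i -> U) :=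
  [set u | N i u /\ forall j (ji : lt j i), I j -> rec j ji <> u].
pose f := Fix wf (fun=> U) (fun i rec => pick (avail i rec)).
have fE i : f i = pick (avail i (fun j _ => f j)).
  rewrite /f Fix_eq // => x g h gh; congr pick.
  suff -> : g = h by [].
  by apply: functional_extensionality_dep => y;
     apply: functional_extensionality_dep => p.
have fP i : I i -> avail i (fun j _ => f j) (f i).
  move=> Ii; rewrite fE; apply: pickP.
  apply: contrapT => H; apply: (ini i Ii).
  have cov u : N i u -> exists j, (I j /\ lt j i) /\ f j = u.
    move=> Nu; apply: contrapT => H'; apply: H; exists u; split=> // j ji Ij fj.
    by apply: H'; exists j.
  apply: card_le_trans (IN _ Ii) _.
  have /choice[s sP] : forall u, exists j, N i u -> (I j /\ lt j i) /\ f j = u.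
    by move=> u; case: (pselect (N i u)) => [/cov[j ?]|?]; [exists j|exists i].
  apply: (@injects_card_le _ _ s); split=> [u /sP[]//|u v /sP[_ +] /sP[_ +] e].
  by rewrite e => -> ->.
exists f; split=> [i /fP[]//|i j Ii Ij fij].
case: (tri i j) => // h.
  by have [_ /(_ _ h Ii)] := fP _ Ij.
by have [_ /(_ _ h Ij)] := fP _ Ii; rewrite fij.
Qed.

(* Hoenig's argument: take a maximal set [A] of choice functions that differ
   pairwise at every index; some projection of [A] is then onto [X i], and all
   projections are injective. *)
Lemma exists_min_card T U (J : set T) (X : T -> set U) :
  J !=set0 -> exists2 i, J i & forall j, J j -> X i #<= X j.
Proof.
move=> [j0 Jj0].
pose P (A : set (T -> U)) := (forall a j, A a -> J j -> X j (a j)) /\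
  (forall a b j, A a -> A b -> J j -> a j = b j -> a = b).
have [F FP Ftot|A [[AX Ainj] Amax]] := @Zorn_bigcup _ P.
  split=> [a j [Y FY Ya]|a b j [Y FY Ya] [Z FZ Zb] Jj ab].
    by have [+ _] := FP _ FY; apply.
  by have [YZ|ZY] := Ftot _ _ FY FZ;
    [have [_] := FP _ FZ|have [_] := FP _ FY]; apply; eauto.
have [i Ji isurj] : exists2 i, J i & forall u, X i u -> exists2 a, A a & a i = u.
  apply: contrapT => H.
  have H1 j : J j -> exists u, X j u /\ forall a, A a -> a j <> u.
    move=> Jj; apply: contrapT => H'; apply: H; exists j => // u Xu.
    apply: contrapT => H; apply: H'; exists u; split=> // a Aa aj.
    by apply: H; exists a.
  have [u0 _] := H1 _ Jj0.
  have /choice[h hP] j : exists u, J j -> X j u /\ forall a, A a -> a j <> u.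
    by case: (pselect (J j)) => [/H1[u ?]|?]; [exists u|exists u0].
  (* Were no projection onto, [h], whose value at each index of [J] is missed by all of [A], could
     be added to [A]. *)
  apply: (Amax (A `|` [set h])).
    split; first by move=> ?; left.
    by move=> /(_ h (or_intror erefl)) /(hP _ Jj0).2; apply.
  split=> [a j [Aa|->] Jj|a b j [Aa|->] [Ab|->] Jj //].
  - exact: AX.
  - exact: (hP _ Jj).1.
  - exact: Ainj.
  - by move=> /((hP _ Jj).2 _ Aa).
  - by move=> /esym /((hP _ Jj).2 _ Ab).
exists i => // j Jj.
case: (pselect (exists u : U, True)) => [[u0 _]|noU]; last first.
  suff -> : X i = set0 by exact: card_ge0.
  by apply/seteqP; split=> // u _; case: noU; exists u.
have /choice[s sP] : forall u, exists a, X i u -> A a /\ a i = u.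
  move=> u; case: (pselect (X i u)) => [/isurj[a ? ?]|?]; first by exists a.
  by exists (fun=> u0).
apply: (@injects_card_le _ _ (fun u => s u j)); split.
  by move=> u /sP[? _]; exact: AX.
move=> u v /sP[Au eu] /sP[Av ev] /(Ainj _ _ _ Au Av Jj) e.
by rewrite -eu -ev e.
Qed.

Lemma card_le_total T (A B : set T) : A #<= B \/ B #<= A.
Proof.
have [|b _ H] := @exists_min_card bool T setT (fun b => if b then A else B).
  by exists true.
by case: b H => H; [left; exact: (H false)|right; exact: (H true)].
Qed.

(** * Arithmetic of infinite cardinals: Hessenberg's theorem and consequences *)

Definition pairing T (h : T -> T -> T) (A : set T) :=
  (forall x y, A x -> A y -> A (h x y)) /\
  (forall x y x' y', A x -> A y -> A x' -> A y' ->
     h x y = h x' y' -> x = x' /\ y = y').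

Lemma infinite_two T (A : set T) : infinite_set A ->
  exists a b, [/\ A a, A b & a <> b].
Proof.
move=> Ainf; have [a Aa] := infinite_setN0 Ainf.
have [|b [Ab ba]] := @infinite_setN0 _ (A `\` [set a]).
  by apply: infinite_setD.
by exists a, b; split=> // ab; apply: ba.
Qed.

Lemma pairing_union T U h (B : set T) (P Q : set U) : infinite_set B ->
  pairing h B -> P #<= B -> Q #<= B -> P `|` Q #<= B.
Proof.
move=> /infinite_two[a [b [Ba Bb ab]]] [hB hinj] PB QB.
have [f [fB finj]] := card_leW a PB.
have [g [gB ginj]] := card_leW a QB.
pose k x := if pselect (P x) then h a (f x) else h b (g x).
apply: (@injects_card_le _ _ k); split.
  move=> x PQx; rewrite /k; case: pselect => Px; apply: hB; auto.
  by apply: gB; case: PQx.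
move=> x y PQx PQy; rewrite /k; case: pselect => Px; case: pselect => Py e.
- by apply: finj => //; apply: (hinj _ _ _ _ _ _ _ _ e).2; auto.
- have Qy : Q y by case: PQy.
  by case: ab; apply: (hinj _ _ _ _ _ _ _ _ e).1; auto.
- have Qx : Q x by case: PQx.
  by case: ab; apply/esym; apply: (hinj _ _ _ _ _ _ _ _ e).1; auto.
- have Qx : Q x by case: PQx.
  have Qy : Q y by case: PQy.
  by apply: ginj => //; apply: (hinj _ _ _ _ _ _ _ _ e).2; auto.
Qed.

Section Hessenberg.
Variables (T : Type) (A : set T).
Hypothesis Ainf : infinite_set A.

(* Partial pairings are represented by their graphs, so that Zorn's lemma
   applies to inclusion; [field G] is the set on which [G] is a pairing. *)
Let field (G : set (T * T * T)) := [set x | exists z, G (x, x, z)].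

Let table (G : set (T * T * T)) :=
  [/\ forall x y z, G (x, y, z) -> [/\ field G x, field G y & field G z],
      forall x y, field G x -> field G y -> exists z, G (x, y, z),
      forall x y z z', G (x, y, z) -> G (x, y, z') -> z = z' &
      forall x y x' y' z, G (x, y, z) -> G (x', y', z) -> x = x' /\ y = y'].

(** Allowing [set0] makes the union of the empty chain qualify; [base] shows that a maximal element
    is not [set0]. *)
Let P G := [/\ table G, field G `<=` A & G = set0 \/ infinite_set (field G)].

Let graph_table h (B : set T) : pairing h B ->
  let G := [set t | [/\ B t.1.1, B t.1.2 & t.2 = h t.1.1 t.1.2] ] in
  table G /\ field G = B.
Proof.
move=> [hB hinj] G.
have FB : field G = B.
  by apply/seteqP; split=> [x [z []]//|x Bx]; exists (h x x).
split=> //; rewrite /table FB; split.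
- by move=> x y z [/= Bx By ->]; split=> //; exact: hB.
- by move=> x y Bx By; exists (h x y).
- by move=> x y z z' [/= _ _ ->] [/= _ _ ->].
- by move=> x y x' y' z [/= Bx By ->] [/= Bx' By']; exact: hinj.
Qed.

Let table_pairing G : table G -> exists2 h, pairing h (field G) &
  forall x y, field G x -> field G y -> G (x, y, h x y).
Proof.
move=> [G1 G2 G3 G4].
have /choice[h hP] (p : T * T) : exists z, field G p.1 -> field G p.2 -> G (p, z).
  case: p => x y; case: (pselect (field G x /\ field G y)) => [[Fx Fy]|nF].
    by have [z ?] := G2 _ _ Fx Fy; exists z.
  by exists x => Fx Fy; case: nF.
have hG x y : field G x -> field G y -> G (x, y, h (x, y)) := hP (x, y).
exists (fun x y => h (x, y)) => //; split=> [x y Fx Fy|x y x' y' Fx Fy Fx' Fy' e].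
  by have [] := G1 _ _ _ (hG _ _ Fx Fy).
by apply: G4 (hG _ _ Fx Fy) _; rewrite e; exact: hG.
Qed.

Let chain (F : set (set (T * T * T))) :
  F `<=` P -> total_on F subset -> P (\bigcup_(X in F) X).
Proof.
move=> FP Ftot; set U := \bigcup_(X in F) X.
have FU X : F X -> field X `<=` field U.
  by move=> FX x [z Xz]; exists z, X.
have two t t' : U t -> U t' -> exists X, [/\ F X, X t & X t'].
  move=> [X FX Xt] [Y FY Yt].
  by have [XY|YX] := Ftot _ _ FX FY; [exists Y|exists X]; split; auto.
split.
- split.
  + move=> x y z [X FX Xt]; have [[H _ _ _] _ _] := FP _ FX.
    by have [? ? ?] := H _ _ _ Xt; split; exact: (FU X).
  + move=> x y [z Uz] [z' Uz']; have [X [FX Xz Xz']] := two _ _ Uz Uz'.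
    have [[_ H _ _] _ _] := FP _ FX.
    have [|//|t Xt] := H x y; [by exists z|by exists z'|by exists t, X].
  + move=> x y z z' Uz Uz'; have [X [FX Xz Xz']] := two _ _ Uz Uz'.
    by have [[_ _ H _] _ _] := FP _ FX; exact: H Xz Xz'.
  + move=> x y x' y' z Uz Uz'; have [X [FX Xz Xz']] := two _ _ Uz Uz'.
    by have [[_ _ _ H] _ _] := FP _ FX; exact: H Xz Xz'.
- by move=> x [z [X FX Xz]]; have [_ H _] := FP _ FX; apply: H; exists z.
have [[X [FX Xinf]]|H] := pselect (exists X, F X /\ infinite_set (field X)).
  by right; apply: sub_infinite_set Xinf; exact: FU.
left; apply/seteqP; split=> // t [X FX Xt].
have [_ _ [X0|Xinf]] := FP _ FX; first by move: Xt; rewrite X0.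
by case: H; exists X.
Qed.

Let base : exists G, P G /\ G !=set0.
Proof.
have [a Aa] := infinite_setN0 Ainf.
move/infiniteP: Ainf => /(card_leW a)[nu [nuA nuinj]].
have {}nuinj i j : nu i = nu j -> i = j by exact: nuinj.
pose B := range nu.
have Bnu i : B (nu i) by exists i.
have Binf : infinite_set B.
  apply/infiniteP; apply: (@injects_card_le _ _ nu); split=> // i j _ _.
  exact: nuinj.
have /choice[k kP] x : exists i, B x -> nu i = x.
  by case: (pselect (B x)) => [[i _ <-]|?]; [exists i|exists 0].
have kN i : k (nu i) = i by apply: nuinj; exact: kP.
pose h x y := nu (choice.pickle (k x, k y)).
have hB : pairing h B.
  split=> [x y _ _|_ _ _ _ [i _ <-] [j _ <-] [i' _ <-] [j' _ <-]].
    exact: Bnu.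
  rewrite /h !kN => /nuinj /(pcan_inj choice.pickleK).
  by case=> -> ->.
have := graph_table hB; set G := [set t | _] => -[tG fG].
exists G; split; first split; [by []| |by right; rewrite fG|].
  by rewrite fG => _ [i _ <-]; exact: nuA.
by exists (nu 0, nu 0, h (nu 0) (nu 0)); split; [exact: Bnu|exact: Bnu|].
Qed.

(** Let [B] be the field of a maximal table. If the rest of [A] embeds in [B], so does [A], and the
    pairing is transported. Otherwise the rest contains a copy [C] of [B]; sending the new pairs of
    the union into [C] extends the table, against maximality. *)
Lemma infinite_pairing : exists h, pairing h A.
Proof.
have [G [[tG GA Ginf] Gmax]] := Zorn_bigcup chain.
have {}Ginf : infinite_set (field G).
  case: Ginf => // G0; have [G' [PG' [t G't]]] := base.
  case: (Gmax G') => //; rewrite G0; split=> // H; exact: (H _ G't).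
have [h hB hG] := table_pairing tG; have [hBc hinj] := hB.
set B := field G in GA Ginf hB hG hBc hinj *.
have [b0 [b1 [Bb0 Bb1 b01]]] := infinite_two Ginf.
have [AB|BA] := card_le_total (A `\` B) B.
  have [k [kB kinj]] : exists k, injects k A B.
    apply: (card_leW b0); apply: card_le_trans (pairing_union Ginf hB (card_lexx B) AB).
    by apply: subset_card_le => x Ax; have [|] := pselect (B x); [left|right].
  exists (fun x y => h (k x) (k y)); split=> [x y Ax Ay|x y x' y' Ax Ay Ax' Ay' e].
    by apply: GA; apply: hBc; exact: kB.
  by have [||||/kinj-> // /kinj->] := hinj _ _ _ _ _ _ _ _ e; auto.
have [g [gA ginj]] := card_leW b0 BA.
pose C := g @` B.
have CB : C #<= B by exact: card_image_le.
have [p [pB pinj]] := card_leW b0 (pairing_union Ginf hB (card_lexx B) CB).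
pose k x y := if pselect (B x /\ B y) then h x y else g (h (p x) (p y)).
have kBC : pairing k (B `|` C).
  split=> [x y Dx Dy|x y x' y' Dx Dy Dx' Dy'].
    rewrite /k; case: pselect => [[Bx By]|nB]; first by left; exact: hBc.
    by right; exists (h (p x) (p y)) => //; apply: hBc; exact: pB.
  have pp a b : (B `|` C) a -> (B `|` C) b -> B (h (p a) (p b)).
    by move=> Da Db; apply: hBc; exact: pB.
  rewrite /k; case: pselect => [[Bx By]|n1]; case: pselect => [[Bx' By']|n2] /= e.
  - exact: hinj e.
  - by have [_ []] := gA _ (pp _ _ Dx' Dy'); rewrite -e; exact: hBc.
  - by have [_ []] := gA _ (pp _ _ Dx Dy); rewrite e; exact: hBc.
  - have {}e := ginj _ _ (pp _ _ Dx Dy) (pp _ _ Dx' Dy') e.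
    by have [||||/pinj-> // /pinj->] := hinj _ _ _ _ _ _ _ _ e; auto.
have := graph_table kBC; set K := [set t | _] => -[tK fK].
case: (Gmax K); last first.
  split; rewrite ?fK //.
  - by move=> x [/GA//|[y By <-]]; have [] := gA _ By.
  - by right; apply: sub_infinite_set Ginf => x; left.
split=> [[[x y] z] Gt|KG].
  have [G1 _ G3 _] := tG; have [Bx By _] := G1 _ _ _ Gt.
  split; [by left|by left|rewrite /= /k; case: pselect => [xy|[]] //=].
  by apply: G3 Gt _; exact: hG.
have [_ []] := gA _ Bb0.
have : K (g b0, g b0, k (g b0) (g b0)).
  by split=> //; right; exists b0.
by move=> /KG Gt; exists (k (g b0) (g b0)).
Qed.

End Hessenberg.

(** The larger of the two parts is infinite, so it absorbs the other one. *)
Lemma infinite_cover T (N P Q : set T) : infinite_set N -> N `<=` P `|` Q ->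
  N #<= P \/ N #<= Q.
Proof.
move=> Ninf NPQ.
wlog PQ : P Q NPQ / P #<= Q => [H|].
  have [/H|/H] := card_le_total P Q; first exact.
  by rewrite setUC => /(_ NPQ)[]; [right|left].
right; have Qinf : infinite_set Q.
  move=> Qfin; apply: Ninf; apply: sub_finite_set NPQ _.
  by rewrite finite_setU; split=> //; exact: card_le_finite PQ Qfin.
have [h hQ] := infinite_pairing Qinf.
apply: card_le_trans (subset_card_le NPQ) _.
exact: pairing_union hQ PQ (card_lexx Q).
Qed.

Fixpoint over T (A : set T) (s : seq T) : Prop :=
  if s is x :: s' then A x /\ over A s' else True.

(** Folding the pairing separates lists of equal length; pairing in the length, coded by an element
    of [A], separates the others. *)
Lemma infinite_over T (A : set T) : infinite_set A ->
  exists enc : seq T -> T, injects enc (over A) A.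
Proof.
move=> Ainf; have [h [hA hinj]] := infinite_pairing Ainf.
have [a Aa] := infinite_setN0 Ainf.
move/infiniteP: (Ainf) => /(card_leW a)[nu [nuA nuinj]].
have {}nuA i : A (nu i) by exact: nuA.
pose e := foldr h a.
have eA s : over A s -> A (e s).
  by elim: s => //= x s IH [Ax As]; apply: hA => //; exact: IH.
exists (fun s => h (nu (size s)) (e s)); split=> [s /eA As|s t As At E].
  exact: hA.
have [| | | |/nuinj st est] := hinj _ _ _ _ _ _ _ _ E; auto.
have {}st : size s = size t by exact: st.
elim: s t st As At est {E} => [|x s IH] [|y t] //= [st] [Ax As] [Ay At] E.
have [| | | |-> /IH-> //] := hinj _ _ _ _ _ _ _ _ E; auto.
Qed.

(* [Y], of cardinality at most [M], is closed under picking [M] neighbors; the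
   children of all its elements are then chosen injectively at one go. *)
Lemma tree_embedding V B (R : V -> V -> Prop) (W M : set V) (D : set B) r :
  W r -> infinite_set M -> D #<= M ->
  (forall y, W y -> M #<= [set z | R y z] `&` W) ->
  exists e : seq B -> V,
    [/\ e [::] = r, forall p, over D p -> W (e p),
        forall i p, over D (i :: p) -> R (e p) (e (i :: p)) &
        forall p q, over D p -> over D q -> e p = e q -> p = q].
Proof.
move=> Wr Minf DM NW.
have [h [hM hinj]] := infinite_pairing Minf.
have [enc [encM encinj]] := infinite_over Minf.
have [ka [kaM kainj]] := card_leW r DM.
have /choice[nu nuP] y : exists f : V -> V,
    W y -> injects f M ([set z | R y z] `&` W).
  case: (pselect (W y)) => [Wy|nW]; last by exists id.
  by have [f ?] := card_leW r (NW _ Wy); exists f.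
(* Words over [M] name the vertices reached from [r] by repeatedly moving to the neighbor with index
   [m]. *)
pose w := foldr (fun m y => nu y m) r.
pose Y := w @` over M.
have wW s : over M s -> W (w s).
  by elim: s => //= m s IH [Mm /IH /nuP[+ _]] => /(_ _ Mm)[].
have Yr : Y r by exists [::].
have YW : Y `<=` W by move=> _ [s Ms <-]; exact: wW.
(* The root is removed so that it never becomes a child, which starts the injectivity induction
   below. *)
have MY y : Y y -> M #<= ([set z | R y z] `&` Y) `\` [set r].
  move=> Yy.
  have MN : M #<= [set z | R y z] `&` Y.
    have [nuN nuinj] := nuP _ (YW _ Yy).
    apply: (@injects_card_le _ _ (nu y)); split=> // m Mm.
    split; first by have [] := nuN _ Mm.
    by case: Yy => s Ms <-; exists (m :: s).
  have Ninf : infinite_set ([set z | R y z] `&` Y).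
    by move=> /(card_le_finite MN).
  have [|H|H] := @infinite_cover _ _ [set r] (([set z | R y z] `&` Y) `\` [set r]) Ninf.
  - by move=> z Nz; have [->|zr] := pselect (z = r); [left|right].
  - by case: Ninf; apply: card_le_finite H _; exact: finite_set1.
  - exact: card_le_trans MN H.
have /choice[s sP] y : exists s, Y y -> over M s /\ w s = y.
  by case: (pselect (Y y)) => [[s ? ?]|?]; [exists s|exists [::]].
(* A pair consists of a parent and a rank. There are at most [M] such pairs, as each parent in [Y]
   is coded by a word over [M]. *)
pose N (t : V * B) := ([set z | R t.1 z] `&` Y) `\` [set r].
have [f [fN finj]] : exists f, (forall t, (Y `*` D) t -> N t (f t)) /\
    (forall t u, (Y `*` D) t -> (Y `*` D) u -> f t = f u -> t = u).
  apply: (injective_choice r) => -[y i] [/= Yy Di].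
  apply: card_le_trans (MY _ Yy).
  apply: (@injects_card_le _ _ (fun t => h (enc (s t.1)) (ka t.2))); split.
    by move=> [y' i'] [/= /sP[? _] ?]; apply: hM; [exact: encM|exact: kaM].
  move=> [y1 i1] [y2 i2] [/= /sP[s1 e1] D1] [/= /sP[s2 e2] D2].
  move=> /hinj[||||/encinj es /kainj ->] //;
    [exact: encM|exact: kaM|exact: encM|exact: kaM|].
  by rewrite -e1 -e2 es.
pose e := foldr (fun i y => f (y, i)) r.
have eY p : over D p -> Y (e p).
  by elim: p => //= i p IH [Di /IH Yp]; have [[]] := fN (e p, i) (conj Yp Di).
exists e; split=> //.
- by move=> p /eY; exact: YW.
- by move=> i p [Di /eY Yp]; have [[]] := fN (e p, i) (conj Yp Di).
elim=> [|i p IH] [|j q] //=.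
- by move=> _ [Dj /eY Yq] E; have [_ []] := fN (e q, j) (conj Yq Dj).
- by move=> [Di /eY Yp] _ E; have [_ []] := fN (e p, i) (conj Yp Di).
- move=> [Di Dp] [Dj Dq] 
    /(finj (e p, i) (e q, j) (conj (eY _ Dp) Di) (conj (eY _ Dq) Dj)).
  by case=> /IH-> // ->.
Qed.

(** * Codes telling apart the vertices of one degree *)

Lemma card_le_powerset T (A B : set T) : A #<= B ->
  [set S | S `<=` A] #<= [set S | S `<=` B].
Proof.
have [[t _] AB|A0 _] := pselect (A !=set0); last first.
  apply: subset_card_le => S SA x /SA Ax.
  by case: A0; exists x.
have [f [fB finj]] := card_leW t AB.
apply: (@injects_card_le _ _ (fun S => f @` S)); split.
  by move=> S SA _ [x Sx <-]; exact/fB/SA.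
have H S S' : S `<=` A -> S' `<=` A -> f @` S = f @` S' -> S `<=` S'.
  move=> SA SA' E x Sx; have : (f @` S) (f x) by exists x.
  by rewrite E => -[y S'y /finj <- //]; auto.
by move=> S S' SA SA' E; apply/seteqP; split; apply: H.
Qed.

(** The neighborhood of the representative will be a common index set for all vertices of one
    degree. *)
Lemma exists_class_representatives V T (N : V -> set T) :
  exists rep : V -> V, (forall v, N (rep v) #= N v) /\
    forall u v, N u #= N v -> rep u = rep v.
Proof.
have [[v0 _]|V0] := pselect (exists v : V, True); last first.
  by exists id; split=> v; case: V0; exists v.
have [pick pickP] := set_picker v0.
exists (fun v => pick [set c | N c #= N v]); split=> [v|u v uv].
  by apply: (pickP [set c | N c #= N v]); exists v; exact: card_eqxx.
congr pick; apply/seteqP; split=> c /= H; first exact: card_eq_trans H uv.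
by apply: card_eq_trans H _; rewrite card_eq_sym.
Qed.

(** Each degree class is no larger than the power set of any of its [h v], so [injective_choice]
    applies class by class. This serves both the roots of trees and the vertices added at a
    stage. *)
Lemma exists_codes V (N h : V -> set V) (I : set V) :
  (forall v, [set u | N u #= N v] #<= [set S | S `<=` N v]) ->
  (forall v, I v -> N v #<= h v) ->
  exists code : V -> set V, (forall v, I v -> code v `<=` h v) /\
    forall u v, I u -> I v -> N u #= N v -> code u = code v -> u = v.
Proof.
move=> few Nh.
have /choice[F FP] c : exists f : V -> set V,
    (forall v, I v -> N v #= N c -> f v `<=` h v) /\
    forall u v, I u -> I v -> N u #= N c -> N v #= N c -> f u = f v -> u = v.
  pose J := [set v | I v /\ N v #= N c].
  have [|f [fh finj]] := @injective_choice _ _ (set0 : set V) J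
      (fun v => [set S | S `<=` h v]).
    move=> v [Iv Nvc].
    apply: (@card_le_trans _ _ _ [set u | N u #= N c]).
      by apply: subset_card_le => u [].
    apply: card_le_trans (few c) _; apply: card_le_powerset.
    by apply: card_le_trans (Nh _ Iv); move/card_eqPle: Nvc => [].
  exists f; split=> [v Iv Nv|u v Iu Iv Nu Nv]; first exact: fh.
  exact: finj.
have [rep [Nrep repE]] := exists_class_representatives N.
exists (fun v => F (rep v) v); split=> [v Iv|u v Iu Iv uv].
  by have [H _] := FP (rep v); apply: H => //; rewrite card_eq_sym.
have [_ H] := FP (rep v); rewrite (repE _ _ uv); apply: H => //.
  by apply: card_eq_trans uv _; rewrite card_eq_sym.
by rewrite card_eq_sym.
Qed.

(** * Transfinite iteration *)

Section Stages.
Context (V : Type) (X0 : set V) (step : set V -> set V).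

(* The empty family [F] gives the first stage [X0]. *)
Inductive stage : set V -> Prop :=
| stage_lim (F : set (set V)) : F `<=` stage ->
    stage (X0 `|` \bigcup_(T in F) T)
| stage_next (T : set V) : stage T -> stage (T `|` step T).

Lemma sub_stage T : stage T -> X0 `<=` T.
Proof.
elim=> [F _|T' _ IH] x Xx; left=> //; exact: IH.
Qed.

Let next T := T `|` step T.

(** These are the extreme points of the Bourbaki-Witt argument, which shows that the stages form a
    chain. *)
Let extreme T := forall T', stage T' -> T' `<=` T -> T' <> T -> next T' `<=` T.

Let extreme_comparable T : stage T -> extreme T ->
  forall T', stage T' -> T' `<=` T \/ next T `<=` T'.
Proof.
move=> sT eT T'; elim=> [F sF IH|{}T' sT' IH].
  have [[M [FM nM]]|H] := pselect (exists M, F M /\ ~ M `<=` T).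
    right; have [//|TM] := IH _ FM.
    by move=> x /TM Mx; right; exists M.
  left=> x [/(sub_stage sT)//|[M FM Mx]].
  by apply: contrapT => nTx; apply: H; exists M; split=> // /(_ _ Mx).
have [T'T|TT'] := IH; last by right=> x /TT' T'x; left.
have [->|neq] := pselect (T' = T); first by right.
by left; exact: eT.
Qed.

Let all_extreme T : stage T -> extreme T.
Proof.
elim=> [F sF IH|{}T sT eT] T' sT' T'T neq.
  have [[M [FM nM]]|H] := pselect (exists M, F M /\ ~ next M `<=` T'); last first.
    case: neq; apply/seteqP; split=> // x [/(sub_stage sT')//|[M FM Mx]].
    apply: contrapT => nx; apply: H; exists M; split=> // /(_ x) H.
    by apply: nx; apply: H; left.
  have MU : M `<=` X0 `|` \bigcup_(T in F) T by move=> x Mx; right; exists M.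
  have [T'M|//] := extreme_comparable (sF _ FM) (IH _ FM) sT'.
  have [eM|nTM] := pselect (T' = M); last first.
    by apply: subset_trans MU; exact: (IH _ FM).
  subst T'; have [M2 [FM2 n2]] : exists M2, F M2 /\ ~ M2 `<=` M.
    apply: contrapT => H; apply: neq; apply/seteqP; split=> //.
    move=> x [/(sub_stage sT')//|[M2 FM2 M2x]].
    by apply: contrapT => nx; apply: H; exists M2; split=> // /(_ _ M2x).
  have [//|H] := extreme_comparable (sF _ FM) (IH _ FM) (sF _ FM2).
  by move=> x /H M2x; right; exists M2.
have [T'T0|nT] := extreme_comparable sT eT sT'; last first.
  by case: neq; apply/seteqP; split.
have [->//|neq'] := pselect (T' = T).
by move=> x /(eT _ sT' T'T0 neq'); left.
Qed.

Lemma stage_comparable T T' : stage T -> stage T' ->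
  T' `<=` T \/ T `|` step T `<=` T'.
Proof. by move=> sT; exact: extreme_comparable sT (all_extreme sT) T'. Qed.

(** Of two stages, one contains the other, and contains its successor too if it is larger; so [v]
    enters by [step] at one stage only. *)
Lemma stage_eq T T' v : stage T -> stage T' -> step T v -> ~ T v ->
  step T' v -> ~ T' v -> T = T'.
Proof.
move=> sT sT' Tv nTv T'v nT'v.
apply/seteqP; split.
  by have [//|H] := stage_comparable sT' sT; case: nTv; apply: H; right.
by have [//|H] := stage_comparable sT sT'; case: nT'v; apply: H; right.
Qed.

Lemma last_stage : exists2 T, stage T & step T `<=` T.
Proof.
(* The union of all stages is itself a stage, so it contains its own successor. *)
set U := X0 `|` \bigcup_(T in stage) T.
have sU : stage U by exact: stage_lim.
exists U => // x Ux; right; exists (U `|` step U); last by right.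
exact: stage_next.
Qed.

End Stages.

(** * Ranked trees *)

Lemma set2_inj T (x y a b : T) : [set x; y] = [set a; b] ->
  x = a /\ y = b \/ x = b /\ y = a.
Proof.
move=> e.
have [xa|xb] : [set a; b] x by rewrite -e; left.
  have [ya|yb] : [set a; b] y by rewrite -e; right.
    have [bx|by_] : [set x; y] b by rewrite e; right.
      by right; rewrite xa ya bx xa.
    by left; rewrite xa by_.
  by left.
have [ax|ay] : [set x; y] a by rewrite e; left.
  have [ya|yb] : [set a; b] y by rewrite -e; right.
    by right.
  by left; rewrite xb yb ax xb.
by right.
Qed.

Lemma cons2_neq T (x y : T) s : [:: x, y & s] <> s.
Proof.
by move=> /(congr1 size) /= /eqP; rewrite -addn2 -[X in _ == X]addn0 eqn_add2l.
Qed.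

Section Trees.
Context (V : Type) (adj : V -> V -> Prop).
Let N v := [set w | adj v w].
Hypothesis Ninf : forall v, infinite_set (N v).
Context (rep : V -> V) (code : V -> set V).
Hypothesis repN : forall v, N (rep v) #= N v.
Hypothesis repE : forall u v, N u #= N v -> rep u = rep v.
Hypothesis code_sub : forall v, code v `<=` N (rep v).
Hypothesis code_inj : forall u v, N u #= N v -> code u = code v -> u = v.
Context (lt : option (V * bool) -> option (V * bool) -> Prop).
Hypothesis lt_wf : well_founded lt.
Hypothesis lt_total : forall i j, [\/ lt i j, i = j | lt j i].
Hypothesis lt_None : forall d, lt None (Some d).

(* [None] is the least rank; the pairs make room for a code, see [top_ranks]. *)
Let rank := option (V * bool).

(** It depends on [r] only through [rep r], so roots of equal degree have the same ranks. *)
Definition ranks (r : V) : set rank :=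
  [set i | if i is Some (d, _) then N (rep r) d else True].

(* Using both values of the boolean makes this set infinite, whatever the code
   is, while [None] is excluded. *)
Definition top_ranks (r : V) : set rank :=
  [set i | if i is Some (d, b) then N (rep r) d /\ (b = true <-> code r d) else False].

(* A vertex of the tree is the list of ranks on the path to the root, which is
   [::]; the head of the list is the rank of the vertex. *)
Fixpoint node (r : V) (p : seq rank) : Prop :=
  match p with
  | [::] => True
  | [:: i] => top_ranks r i
  | i :: (j :: _) as q => [/\ ranks r i, lt i j & node r q]
  end.

(** The tree need not be induced: other adjacencies between its nodes are allowed. *)
Definition is_tree (e : seq rank -> V) :=
  (forall p q, node (e [::]) p -> node (e [::]) q -> e p = e q -> p = q) /\
  (forall i p, node (e [::]) (i :: p) -> adj (e p) (e (i :: p))).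

Definition nodes (e : seq rank -> V) := e @` node (e [::]).

Lemma node_behead r i p : node r (i :: p) -> node r p.
Proof. by case: p => [|j p] //= []. Qed.

Lemma top_rank_rank r : top_ranks r `<=` ranks r.
Proof. by move=> [[d b] []|]. Qed.

Lemma over_node r p : node r p -> over (ranks r) p.
Proof.
elim: p => // i p IH h; split; last exact/IH/node_behead/h.
by case: p {IH} h => [/top_rank_rank|j p []].
Qed.

(** Ranks are coded by lists of length at most two over [N (rep r)]. *)
Lemma card_ranks r : ranks r #<= N r.
Proof.
have [enc [encN encinj]] := infinite_over (@Ninf (rep r)).
apply: (@card_le_trans _ _ _ (N (rep r))); last first.
  by move/card_eqPle: (repN r) => [].
pose l (i : rank) := match i with
  | None => [::] | Some (d, false) => [:: d] | Some (d, true) => [:: d; d] end.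
have lo i : ranks r i -> over (N (rep r)) (l i) by case: i => [[d []]|].
apply: (@injects_card_le _ _ (enc \o l)); split=> [i ri|i j ri rj /=].
  exact/encN/lo.
move=> /(encinj _ _ (lo _ ri) (lo _ rj)).
by case: i j {ri rj} => [[d []]|] [[d' []]|] //= [->].
Qed.

Lemma two_top_ranks r : exists i j, [/\ top_ranks r i, top_ranks r j & i <> j].
Proof.
have [a [b [Na Nb ab]]] := infinite_two (@Ninf (rep r)).
exists (Some (a, `[< code r a >])), (Some (b, `[< code r b >])); split.
- by split=> //; split=> /asboolP.
- by split=> //; split=> /asboolP.
- by case.
Qed.

Lemma top_ranks_inj u v : N u #= N v -> top_ranks u = top_ranks v -> u = v.
Proof.
move=> uv; have uvr := repE uv.
have H x y : rep x = rep y -> top_ranks x = top_ranks y -> code x `<=` code y.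
  move=> xy e d cd; have : top_ranks x (Some (d, true)).
    by split; [exact: code_sub cd|].
  by rewrite e => -[_ [+ _]]; exact.
by move=> e; apply: code_inj => //; apply/seteqP; split; exact: H.
Qed.

(** Rooted at a vertex [r] of least degree in [W], the tree has room everywhere: each vertex of [W]
    has at least as many neighbors in [W] as [r] has neighbors. *)
Lemma exists_tree (W : set V) : W !=set0 ->
  (forall v, W v -> N v #<= N v `&` W) ->
  exists2 e, is_tree e & nodes e `<=` W.
Proof.
move=> Wne NW; have [r Wr rmin] := exists_min_card N Wne.
have [|e [er eW eadj einj]] := tree_embedding (R := adj) Wr (@Ninf r) (card_ranks r).
  by move=> y Wy; apply: card_le_trans (rmin _ Wy) (NW _ Wy).
exists e; first split.
- by rewrite er => p q /over_node p' /over_node q'; exact: einj.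
- by rewrite er => i p /over_node; exact: eadj.
by rewrite /nodes er => _ [p /over_node p' <-]; exact: eW.
Qed.

(** * Forests: recognizing leaves and roots *)

Section Forest.
Context (E : set (seq rank -> V)).
Hypothesis Etree : E `<=` is_tree.
Hypothesis Edisj : forall e e' x, E e -> E e' -> nodes e x -> nodes e' x -> e = e'.

Definition tree_edge x y := exists e i p,
  [/\ E e, node (e [::]) (i :: p), x = e p & y = e (i :: p)].

Definition red x y := tree_edge x y \/ tree_edge y x.

Lemma nodeE e p e' p' : E e -> E e' -> node (e [::]) p -> node (e' [::]) p' ->
  e p = e' p' -> e = e' /\ p = p'.
Proof.
move=> Ee Ee' np np' eq; have ee' : e = e'.
  by apply: (Edisj (x := e p)) => //; [exists p|exists p'].
split=> //; subst e'; have [H _] := Etree Ee; exact: H.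
Qed.

Lemma red_node e p y : E e -> node (e [::]) p -> red (e p) y <->
  (exists2 i, node (e [::]) (i :: p) & y = e (i :: p)) \/
  (exists i q, p = i :: q /\ y = e q).
Proof.
move=> Ee np; split.
  case=> [[e' [i [q [Ee' nq eq ->]]]]|[e' [i [q [Ee' nq -> eq]]]]].
    have [? ?] := nodeE Ee Ee' np (node_behead nq) eq; subst e' q.
    by left; exists i.
  have [? ?] := nodeE Ee Ee' np nq eq; subst e' p.
  by right; exists i, q.
case=> [[i ni ->]|[i [q [pE ->]]]]; first by left; exists e, i, p.
by right; exists e, i, q; rewrite -pE.
Qed.

Lemma red_nodes x y : red x y -> exists e p, [/\ E e, node (e [::]) p & x = e p].
Proof.
case=> [[e [i [p [Ee np -> _]]]]|[e [i [p [Ee np _ ->]]]]].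
  by exists e, p; split=> //; exact: node_behead np.
by exists e, (i :: p).
Qed.

(** Vertices off the forest qualify too. Being phrased through [red] alone, this notion and the next
    are invariant under automorphisms preserving [red]. *)
Definition leaflike x := forall y z, red x y -> red x z -> y = z.
Definition rootlike x := ~ leaflike x /\ forall y, red x y -> ~ leaflike y.

Lemma leaflike_bottom e p : E e -> node (e [::]) (None :: p) ->
  leaflike (e (None :: p)).
Proof.
move=> Ee np y z /(red_node _ Ee np) + /(red_node _ Ee np).
have nochild i : ~ node (e [::]) [:: i, None & p].
  move=> [_ iN _]; case: i iN => [d dN|]; last exact: wf_irrefl lt_wf _.
  have := lt_None d => Nd.
  (* A rank [Some d] below [None] would, being also above it, give an infinite descent. *)
  suff : forall i, ~ (i = None \/ i = Some d) by move=> /(_ None); apply; left.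
  by elim/(well_founded_ind lt_wf) => i IH [?|?]; subst i;
     [apply: (IH (Some d))|apply: (IH None)]; auto.
case=> [[i /nochild//]|[i [q [[_ pq] ->]]]].
case=> [[i' /nochild//]|[i' [q' [[_ pq'] ->]]]].
by rewrite -pq -pq'.
Qed.

(** The child of rank [None] and the parent are two distinct red neighbors, the first of them
    leaflike. *)
Lemma not_leaflike_inner e d p : E e -> node (e [::]) (Some d :: p) ->
  exists y, [/\ red (e (Some d :: p)) y, leaflike y & ~ leaflike (e (Some d :: p))].
Proof.
move=> Ee np.
have nN : node (e [::]) [:: None, Some d & p] by split.
exists (e [:: None, Some d & p]).
have r1 : red (e (Some d :: p)) (e [:: None, Some d & p]).
  by apply/(red_node _ Ee np); left; exists None.
have r2 : red (e (Some d :: p)) (e p).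
  by apply/(red_node _ Ee np); right; exists (Some d), p.
split=> //; first exact: leaflike_bottom.
move=> /(_ _ _ r1 r2) eq.
have [_] := nodeE Ee Ee nN (node_behead np) eq.
exact: cons2_neq.
Qed.

(** A root has two children, and none of rank [None], so all its neighbors are inner nodes. Any
    other node is leaflike or has a leaflike child. *)
Lemma rootlikeP x : rootlike x <-> exists2 e, E e & x = e [::].
Proof.
split=> [[nlx rx]|[e Ee ->]].
  have [y xy] : exists y, red x y.
    by apply: contrapT => H; apply: nlx => y z xy; case: H; exists y.
  have [e [[|i p] [Ee np xE]]] := red_nodes xy; first by exists e.
  case: i np xE => [d|] np xE; last first.
    by case: nlx; rewrite xE; exact: leaflike_bottom.
  have [z [xz lz _]] := not_leaflike_inner Ee np.
  by case: (rx z) => //; rewrite xE.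
have n0 : node (e [::]) [::] by [].
split=> [lr|y /(red_node _ Ee n0)[[i ni ->]|[i [q []]//]]].
  have [i [j [ti tj ij]]] := two_top_ranks (e [::]).
  have eq : e [:: i] = e [:: j].
    by apply: lr; apply/(red_node _ Ee n0); left; [exists i|exists j].
  have ni : node (e [::]) [:: i] by [].
  have nj : node (e [::]) [:: j] by [].
  by have [_ []] := nodeE Ee Ee ni nj eq.
case: i ni => // d ni.
by have [z []] := not_leaflike_inner Ee ni.
Qed.

(** * Automorphisms fix the forest pointwise *)

Section Automorphism.
Context (phi : V -> V).
Hypothesis phi_inj : injective phi.
Hypothesis phi_surj : forall y, exists x, phi x = y.
Hypothesis phi_red : forall x y, red (phi x) (phi y) <-> red x y.
Hypothesis phi_deg : forall x, N (phi x) #= N x.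

Lemma leaflike_phi x : leaflike (phi x) <-> leaflike x.
Proof.
split=> lx y z.
  by move=> /phi_red xy /phi_red xz; apply: phi_inj; exact: lx.
have [y' <-] := phi_surj y; have [z' <-] := phi_surj z.
by move=> /phi_red xy /phi_red xz; rewrite (lx y' z').
Qed.

Lemma rootlike_phi x : rootlike x -> rootlike (phi x).
Proof.
move=> [nlx rx]; split; first by move/leaflike_phi.
move=> y; have [y' <-] := phi_surj y.
by move=> /phi_red /rx nl /leaflike_phi.
Qed.

(** The image of the child is a red neighbor of [e' p']. It is not the parent, since the last
    hypothesis makes the parent the image of another vertex. *)
Lemma child_image e e' p p' i : E e -> E e' ->
  node (e [::]) (i :: p) -> node (e' [::]) p' -> phi (e p) = e' p' ->
  (forall j' q', p' = j' :: q' -> exists2 x, phi x = e' q' & x <> e (i :: p)) ->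
  exists2 i', node (e' [::]) (i' :: p') & phi (e (i :: p)) = e' (i' :: p').
Proof.
move=> Ee Ee' ni np' eq par.
have : red (e p) (e (i :: p)).
  by apply/(red_node _ Ee (node_behead ni)); left; exists i.
move/phi_red; rewrite eq => /(red_node _ Ee' np') [[i' ? ?]|[j' [q' [pE E1]]]].
  by exists i'.
by have [x xq nx] := par _ _ pE; case: nx; apply: phi_inj; rewrite xq.
Qed.

Lemma child_preimage e e' p p' i' : E e -> E e' ->
  node (e [::]) p -> node (e' [::]) (i' :: p') -> phi (e p) = e' p' ->
  (forall j q, p = j :: q -> phi (e q) <> e' (i' :: p')) ->
  exists2 i, node (e [::]) (i :: p) & phi (e (i :: p)) = e' (i' :: p').
Proof.
move=> Ee Ee' np ni' eq par.
have [y yE] := phi_surj (e' (i' :: p')).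
have : red (e' p') (e' (i' :: p')).
  by apply/(red_node _ Ee' (node_behead ni')); left; exists i'.
rewrite -eq -yE => /phi_red /(red_node _ Ee np) [[i ? yi]|[j [q [pE yq]]]].
  by exists i => //; rewrite -yi.
by case: (par _ _ pE); rewrite -yq.
Qed.

Lemma grandchild_neq e i j p : E e -> node (e [::]) [:: i, j & p] ->
  e p <> e [:: i, j & p].
Proof.
move=> Ee np eq.
have [_] := nodeE Ee Ee (node_behead (node_behead np)) np eq.
by move/esym; exact: cons2_neq.
Qed.

(* Induction on [i]: the ranks of the children are preserved, and [lt] is
   extensional. *)
Lemma phi_rank e e' i i' p p' : E e -> E e' -> ranks (e [::]) = ranks (e' [::]) ->
  node (e [::]) (i :: p) -> node (e' [::]) (i' :: p') ->
  phi (e p) = e' p' -> phi (e (i :: p)) = e' (i' :: p') -> i = i'.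
Proof.
move=> Ee Ee' rr; elim/(well_founded_ind lt_wf): i i' p p'.
move=> i IH i' p p' ni ni' eqp eqi.
have [o1 _] := over_node ni; have [o2 _] := over_node ni'.
(* The node of larger rank has a child of the smaller rank. The counterpart of this child in the
   other tree has a still smaller rank, yet by induction the same one. *)
case: (lt_total i i') => // ii'; exfalso.
  have nj' : node (e' [::]) [:: i, i' & p'] by split=> //; rewrite -rr.
  have [|j nj eqj] := child_preimage Ee Ee' ni nj' eqi.
    move=> _ _ [_ <-]; rewrite eqp; exact: grandchild_neq.
  have [_ ji _] := nj.
  have ? := IH _ ji _ _ _ nj nj' eqi eqj; subst j.
  exact: wf_irrefl lt_wf _ ji.
have nj : node (e [::]) [:: i', i & p] by split=> //; rewrite rr.
have [|j' nj' eqj] := child_image Ee Ee' nj ni' eqi.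
  by move=> _ _ [_ <-]; exists (e p) => //; exact: grandchild_neq.
have [_ ji' _] := nj'.
have ? := IH _ ii' _ _ _ nj nj' eqi eqj; subst j'.
exact: wf_irrefl lt_wf _ ji'.
Qed.

Lemma ranks_phi (e e' : seq rank -> V) : phi (e [::]) = e' [::] -> ranks (e [::]) = ranks (e' [::]).
Proof. by move=> eq; rewrite /ranks -eq (repE (phi_deg (e [::]))). Qed.

(** The image is a root of the same degree, and the ranks of the children are preserved, so both
    roots have the same code. *)
Lemma phi_root e : E e -> phi (e [::]) = e [::].
Proof.
move=> Ee; have /rootlike_phi/rootlikeP[e' Ee' eq] : rootlike (e [::]).
  by apply/rootlikeP; exists e.
have rr := ranks_phi eq.
rewrite eq; apply: top_ranks_inj; first by rewrite -eq.
apply/seteqP; split=> i ti.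
  have ni' : node (e' [::]) [:: i] by [].
  have [//|j nj eqj] := child_preimage (p := [::]) Ee Ee' I ni' eq.
  by rewrite -(phi_rank Ee Ee' rr nj ni' eq eqj).
have ni : node (e [::]) [:: i] by [].
have [//|j nj eqj] := child_image (p' := [::]) Ee Ee' ni I eq.
by rewrite (phi_rank Ee Ee' rr ni nj eq eqj).
Qed.

Lemma phi_nodes e : E e -> forall p, node (e [::]) p -> phi (e p) = e p.
Proof.
move=> Ee p np.
(* The induction carries the parent along because [child_image] must exclude it. *)
suff [] : phi (e p) = e p /\ phi (e (behead p)) = e (behead p) by [].
elim: p np => [|i p IH] np; first by split; exact: phi_root.
have [IH1 IH2] := IH (node_behead np); split=> //=.
have [|j nj eqj] := child_image Ee Ee np (node_behead np) IH1.
  move=> j' q' pE; move: pE np IH2 => -> /= np IH2.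
  by exists (e q') => //; exact: grandchild_neq.
by rewrite eqj -(phi_rank Ee Ee erefl np nj IH1 eqj).
Qed.

End Automorphism.
End Forest.
End Trees.

(** * The coloring *)

Lemma exists_pointed_well_order T : exists lt : option T -> option T -> Prop,
  [/\ well_founded lt, forall i j, [\/ lt i j, i = j | lt j i] &
      forall d, lt None (Some d)].
Proof.
have [lt [wf tot]] := exists_well_order T.
exists (fun i j => match i, j with
  | None, Some _ => True | Some x, Some y => lt x y | _, None => False end).
have accN : Acc (fun i j => match i, j with
  | None, Some _ => True | Some x, Some y => lt x y | _, None => False end) None.
  by constructor=> -[].
split; [case; [|exact: accN]| |by []].
  move=> x; elim/(well_founded_ind wf): x => x IH.
  by constructor => -[y yx|_]; [exact: IH|exact: accN].
move=> [x|] [y|]; [|by constructor|by constructor|by constructor].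
by case: (tot x y) => [?|->|?]; constructor.
Qed.

Lemma distinguishing_injective G C C' (g : C -> C') (c : edge_coloring G C) :
  injective g -> distinguishing c -> distinguishing (fun e => g (c e)).
Proof.
move=> ginj cd f fa fp; apply: cd => // e.
by have [e' [e'E /ginj ?]] := fp e; exists e'.
Qed.

(** The least finite number of colors is also least among all cardinals, since infinite color types
    are larger. *)
Lemma is_distinguishing_index_le G n (c : edge_coloring G 'I_n) :
  distinguishing c -> exists D, is_distinguishing_index G D /\ [set: D] #<= `I_n.
Proof.
move=> cd.
pose P k := `[< exists c : edge_coloring G 'I_k, distinguishing c >].
have exP : exists k, P k by exists n; apply/asboolP; exists c.
case: (ex_minnP exP) => k /asboolP[ck ckd] kmin.
have ordle m : ([set: 'I_k] #<= `I_m) = (k <= m).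
  by rewrite (card_le_eql (card_esym (@card_II k))) card_le_II.
exists 'I_k; split; last first.
  by rewrite ordle; apply: kmin; apply/asboolP; exists c.
split; first by exists ck.
move=> C [c' c'd]; have [[m Cm]|Cinf] := pselect (finite_set [set: C]).
  rewrite (card_le_eqr Cm) ordle; apply: kmin; apply/asboolP.
  have [g [gm ginj]] : exists g : C -> nat, injects g setT `I_m.
    by apply: (card_leW 0); move/card_eqPle: Cm => [].
  exists (fun e => Ordinal (gm (c' e) I)).
  apply: (distinguishing_injective (g := fun x => Ordinal (gm x I))) => // x y.
  by case=> /ginj; apply.
move/infiniteP: Cinf; apply: card_le_trans.
by rewrite (card_le_eql (card_esym (@card_II k))); exact: card_leT.
Qed.

Lemma powerset_bound (G : graph) (v : G) :
  (forall A : Type, infinite_set [set: A] ->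
     [set v : G | has_degree v A] #<= [set: A -> bool]) ->
  infinite_set (neighbors v) ->
  [set u : G | neighbors u #= neighbors v] #<= [set S | S `<=` neighbors v].
Proof.
move=> few vinf; pose A : Type := set_type (neighbors v).
have TA : [set: A] #= neighbors v by exact: card_setT.
have Ainf : infinite_set [set: A].
  by move=> [n An]; apply: vinf; exists n; apply: card_eq_trans An; rewrite card_eq_sym.
apply: (@card_le_trans _ _ _ [set u : G | has_degree u A]).
  apply: subset_card_le => u /= uv; apply: card_eq_trans uv _.
  by rewrite card_eq_sym.
apply: card_le_trans (few A Ainf) _.
apply: (@injects_card_le _ _ (fun f : A -> bool => [set set_val x | x in [set x | f x] ])).
split=> [f _ _ [x _ <-]|f g _ _ fg]; first exact: set_valP.
have H f' g' x : [set set_val x | x in [set x : A | f' x] ] =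
    [set set_val x | x in [set x : A | g' x] ] -> f' x -> g' x.
  move=> e fx; have : [set set_val x | x in [set x : A | f' x] ] (set_val x) by exists x.
  by rewrite e => -[y gy /val_inj <-].
by apply: functional_extensionality_dep => x; apply/idP/idP; [exact: H fg|exact: H (esym fg)].
Qed.

Section Coloring.
Context (G : graph).
Hypothesis infinite_degrees : forall v : G, infinite_set (neighbors v).
Hypothesis few : forall v : G,
  [set u : G | neighbors u #= neighbors v] #<= [set S | S `<=` neighbors v].

Lemma exists_distinguishing_coloring :
  exists c : edge_coloring G 'I_3, distinguishing c.
Proof.
pose N := @neighbors G.
have [rep [repN repE]] := exists_class_representatives N.
have [|code [code_sub code_inj]] := @exists_codes _ N (N \o rep) setT few.
  by move=> v _; move/card_eqPle: (repN v) => [].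
have {}code_sub v : code v `<=` N (rep v) by exact: code_sub.
have {}code_inj u v : N u #= N v -> code u = code v -> u = v by exact: code_inj.
have [lt [lt_wf lt_total lt_None]] := exists_pointed_well_order (G * bool).
pose tree := is_tree (@adj G) rep code lt.
pose F := nodes (@adj G) rep code lt.
have [E [Etree Etriv Emax]] :=
  ex_maximal_disjoint_subcollection F [set e | tree e].
have Edisj e e' x : E e -> E e' -> F e x -> F e' x -> e = e'.
  by move=> Ee Ee' ex e'x; apply: Etriv => //; exists x.
pose X0 := \bigcup_(e in E) F e.
pose redv := red (@adj G) rep code lt E.
have red_X0 x y : redv x y -> X0 x /\ X0 y.
  move=> xy; have [e [p [Ee np ->]]] := red_nodes xy.
  have yx : redv y x by case: xy; [right|left].
  have [e' [p' [Ee' np' ->]]] := red_nodes yx.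
  by split; [exists e => //; exists p|exists e' => //; exists p'].
have red_adj x y : redv x y -> adj x y.
  move=> [] [e [i [p [Ee np -> ->]]]]; last apply: adj_sym;
    by have [_ H] := Etree _ Ee; exact: H.
pose step T := [set v | N v #<= N v `&` T].
have /choice[cd cdP] T : exists c : G -> set G,
    (forall v, step T v -> c v `<=` N v `&` T) /\
    forall u v, step T u -> step T v -> N u #= N v -> c u = c v -> u = v.
  exact: (@exists_codes _ N (fun v => N v `&` T) (step T) few).
pose redE (s : set G) := exists x y, redv x y /\ s = [set x; y].
(* Such an edge joins a vertex [v] entering just after the stage [T] to a member [u] of its code in
   [T]. *)
pose blueE (s : set G) := exists T v u,
  [/\ stage X0 step T, step T v, ~ T v, cd T v u & s = [set v; u] ].
have redP x y : redE [set x; y] <-> redv x y.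
  split=> [[a [b [ab E0]]]|xy]; last by exists x, y.
  have e := set2_inj E0.
  by case: e => -[-> ->] //; case: ab; [right|left].
(* The ends enter at different times, so the unordered pair reveals which end is new, and [stage_eq]
   recovers the stage. *)
have blueP T v u : stage X0 step T -> step T v -> ~ T v -> T u ->
    blueE [set v; u] <-> cd T v u.
  move=> sT Tv nTv Tu; split=> [|cvu]; last by exists T, v, u.
  move=> [T' [v' [u' [sT' T'v' nT'v' cvu E0]]]]; have e := set2_inj E0.
  case: e => -[? ?].
    by subst v' u'; rewrite (stage_eq sT sT' Tv nTv T'v' nT'v').
  subst v' u'; have [_ T'v] := (cdP T').1 _ T'v' _ cvu.
  have [T'T|TT'] := stage_comparable sT sT'; first by case: nTv; exact: T'T.
  by case: nT'v'; apply: TT'; left.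
pose o2 : 'I_3 := Ordinal (isT : 2 < 3); pose o1 : 'I_3 := Ordinal (isT : 1 < 3).
pose col s : 'I_3 := if `[< redE s >] then o2 else if `[< blueE s >] then o1 else ord0.
have col_red s s' : col s = col s' -> redE s -> redE s'.
  rewrite /col => + rs; rewrite (asboolT rs); case: asboolP => // _.
  by case: asboolP.
have col_blue s s' : col s = col s' -> ~ redE s -> blueE s -> blueE s'.
  rewrite /col => + nrs bs; rewrite (asboolF nrs) (asboolT bs).
  by case: asboolP => // _; case: asboolP.
exists (fun e => col (sval e)) => phi [[psi phiK psiK] phi_adj] phi_col.
have phi_inj : injective phi by exact: can_inj phiK.
have phi_surj y : exists x, phi x = y by exists (psi y).
have colE x y : adj x y -> col [set phi x; phi y] = col [set x; y].
  move=> xy; have xyE : is_edge [set x; y] by exists x, y.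
  have [e' [e'E /= <-]] := phi_col (exist _ _ xyE).
  by congr col; rewrite e'E /= image_setU !image_set1.
have phi_red x y : redv (phi x) (phi y) <-> redv x y.
  split=> /[dup] rxy /red_adj xy; apply/redP.
    have {}xy : adj x y by exact/phi_adj.
    by apply: col_red (colE _ _ xy) _; exact/redP.
  by apply: col_red (esym (colE _ _ xy)) _; exact/redP.
have phi_deg x : N (phi x) #= N x.
  suff -> : N (phi x) = phi @` N x by apply: inj_card_eq => a b _ _; exact: phi_inj.
  apply/seteqP; split=> [y xy|_ [y xy <-]]; last exact/phi_adj.
  by exists (psi y) => //; apply/phi_adj; rewrite psiK.
have fixX0 x : X0 x -> phi x = x.
  move=> [e Ee [p np <-]].
  exact: (phi_nodes infinite_degrees repE code_sub code_inj lt_wf lt_total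
    lt_None Etree Edisj phi_inj phi_surj phi_red phi_deg Ee np).
have fix_stage T : stage X0 step T -> forall v, T v -> phi v = v.
  elim=> [C _ IH v [/fixX0//|[T' CT' T'v]]|{}T sT IH v [/IH//|Tv]].
    exact: IH CT' _ T'v.
  have [/IH//|nTv] := pselect (T v).
  have nTv' : ~ T (phi v) by move=> /[dup] /IH /phi_inj ->.
  have adjT u : T u -> N v u <-> N (phi v) u.
    by move=> /IH Tu; rewrite /N /= -{2}Tu; split=> /phi_adj.
  have Tv' : step T (phi v).
    rewrite /step /= (card_le_eql (phi_deg v)); apply: card_le_trans Tv _.
    by apply: subset_card_le => u [vu Tu]; split=> //; exact/adjT.
  have [cN cinj] := cdP T.
  (* Red edges lie within [X0], hence within [T], so color 2 never hides the code of a new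
     vertex. *)
  have nred w u : ~ T w -> ~ redE [set w; u].
    by move=> nTw /redP/red_X0[/(sub_stage sT)].
  (* As [T] is fixed pointwise and colors are preserved, [v] and [phi v] have the same code in
     [T]. *)
  apply: cinj => //; apply/seteqP; split=> u cu.
    have [vu Tu] := cN _ Tv' _ cu; apply/(blueP T) => //.
    have {}vu : adj v u by exact/adjT.
    have e : [set phi v; u] = [set phi v; phi u] by rewrite (IH u Tu).
    apply: col_blue (colE _ _ vu) _ _; rewrite -e; first exact: nred.
    exact/(blueP T).
  have [vu Tu] := cN _ Tv _ cu; apply/(blueP T) => //.
  have e : [set phi v; u] = [set phi v; phi u] by rewrite (IH u Tu).
  rewrite e; apply: col_blue (esym (colE _ _ vu)) _ _; first exact: nred.
  exact/(blueP T).
have [T sT stepT] := last_stage X0 step.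
move=> x; apply: (fix_stage T) => //; apply: contrapT => nTx.
have [||e te eW] := exists_tree infinite_degrees code repN lt (W := ~` T).
- by exists x.
- move=> v nTv.
  (* One side of [T] contains as many neighbors of [v] as there are in all; it is not [T], or [v]
     would belong to [step T]. *)
  have [|H|//] := @infinite_cover _ _ (N v `&` T) (N v `&` ~` T) (@infinite_degrees v).
    by move=> u vu; have [Tu|nTu] := pselect (T u); [left|right].
  by case: nTv; exact: stepT.
have Fe0 : F e (e [::]) by exists [::].
have FeX0 y : F e y -> ~ X0 y by move=> /eW nTy /(sub_stage sT).
apply: (Emax (E `|` [set e])).
- split; first by move=> ?; left.
  by move=> /(_ e (or_intror erefl)) Ee; apply: (FeX0 _ Fe0); exists e.
- by move=> e' [/Etree//|->].
move=> e1 e2 [E1|->] [E2|->] [y [y1 y2]] //.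
- exact: Edisj y1 y2.
- by case: (FeX0 _ y2); exists e1.
- by case: (FeX0 _ y1); exists e2.
Qed.

End Coloring.

Theorem theorem4 (G : graph)
  (infinite_degrees : forall v : G, infinite_set (neighbors v))
  (few_of_each_degree : forall A : Type, infinite_set [set: A] ->
     [set v : G | has_degree v A] #<= [set: A -> bool]) :
  exists D : Type, is_distinguishing_index G D /\ [set: D] #<= `I_3.
Proof.
have [c cd] := exists_distinguishing_coloring infinite_degrees
  (fun v => powerset_bound few_of_each_degree (infinite_degrees v)).
exact: is_distinguishing_index_le cd.
Qed.
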